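(* Let $E:\mathbb{R}^d\to GL(\mathbb{R}^d)$ be an admissible exponent, let $\sigma$ be a finite measure on $\mathbb{S}^{d-1}$, let $\phi_x$ be the operator-stable-like L\'evy measure with exponent $E(x)$ and spherical measure $\sigma$, and let $$q(x,\xi)=\int_{\mathbb{S}^{d-1}}\int_0^\infty\left(1-e^{i\langle r^{E(x)}\theta,\xi\rangle}+1_{\{0<r<1\}}\,i\langle r^{E(x)}\theta,\xi\rangle\right)\frac{dr}{r^2}\,\sigma(d\theta),\qquad x,\xi\in\mathbb{R}^d.$$ If $\sigma$ is symmetric on $\mathbb{S}^{d-1}$, i.e. $\sigma(A)=\sigma(-A)$ for all Borel $A\subset\mathbb{S}^{d-1}$, then for all $x,\xi\in\mathbb{R}^d$ $$q(x,\xi)=\int_{\mathbb{S}^{d-1}}\int_0^\infty\left(1-\cos(\langle r^{E(x)}\theta,\xi\rangle)\right)\frac{dr}{r^2}\,\sigma(d\theta)=\int_{\mathbb{R}^d\setminus\{0\}}\left(1-\cos(\langle y,\xi\rangle)\right)\phi_x(dy).$$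
   Context: $\|\cdot\|$ is the Euclidean norm on $\mathbb{R}^d$ and also the induced operator norm on $d\times d$ matrices; $\langle\cdot,\cdot\rangle$ is the Euclidean scalar product; $\mathbb{S}^{d-1}$ is the Euclidean unit sphere. For $r>0$ and a matrix $A$, $r^A:=\exp(A\ln r)$. $\lambda(x)$ denotes the minimum of the real parts of the eigenvalues of $E(x)$. Admissible exponent: a map $E:\mathbb{R}^d\to GL(\mathbb{R}^d)$ such that (E1) $E(x)$ is symmetric for every $x$; (E2) there is a constant $C>0$ with $\|E(y)-E(x)\|\le C\|y-x\|$ for all $x,y\in\mathbb{R}^d$; (E3) there is a constant $a>1/2$ with $a\le\lambda(x)$ for all $x\in\mathbb{R}^d$. The operator-stable-like L\'evy measure with exponent $E(x)$ and finite spherical measure $\sigma$ is $$\phi_x(A)=\int_{\mathbb{S}^{d-1}}\int_0^\infty1_A(r^{E(x)}\theta)\,\frac{dr}{r^2}\,\sigma(d\theta),\qquad A\subset\mathbb{R}^d\setminus\{0\}\text{ Borel}.$$ The function $q$ is the symbol of the process solving $X_t=X_0+\int_0^t\int_{\mathbb{S}^{d-1}}\int_0^1r^{E(X_{s-})}\theta\,\tilde N(ds,d\theta,dr)+\int_0^t\int_{\mathbb{S}^{d-1}}\int_1^\infty r^{E(X_{s-})}\theta\,N(ds,d\theta,dr)$, with $N$ a Poisson random measure of intensity $ds\otimes\sigma(d\theta)\otimes r^{-2}dr$ and $\tilde N$ its compensated version. *)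

(* Defs.v *)
From HB Require Import structures.
From mathcomp Require Import all_boot all_order all_algebra.
From mathcomp Require Import complex.
From mathcomp Require Import all_classical all_reals all_analysis.

Set Implicit Arguments.
Unset Strict Implicit.
Unset Printing Implicit Defensive.

Import Order.TTheory GRing.Theory Num.Theory.
Import numFieldNormedType.Exports.

Local Open Scope classical_set_scope.
Local Open Scope ring_scope.

(* The dimension d >= 1 is written n.+1 throughout, so that the unit sphere is
   inhabited (a measurableType must be pointed). *)

Section Euclidean.
Context {R : realType} {n : nat}.

Definition dotp (u v : 'cV[R]_n.+1) : R := \sum_i u i 0 * v i 0.

(* Not `|u|, which is the sup norm on matrices. *)
Definition enorm (u : 'cV[R]_n.+1) : R := Num.sqrt (dotp u u).

Definition opnorm (A : 'M[R]_n.+1) : R :=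
  sup [set enorm (A *m u) | u in [set u | enorm u = 1]].

Definition expmx (A : 'M[R]_n.+1) : 'M[R]_n.+1 :=
  limn (series (fun k => k`!%:R^-1 *: A ^+ k)).

Definition rpow (r : R) (A : 'M[R]_n.+1) : 'M[R]_n.+1 := expmx (ln r *: A).

(* The spectrum is finite and nonempty, so this infimum is a minimum. *)
Definition lambda_min (A : 'M[R]_n.+1) : R :=
  inf [set complex.Re z | z in
        [set z : R[i] | eigenvalue (map_mx (real_complex R) A) z]].

End Euclidean.

Section Exponent.
Context {R : realType} {n : nat}.

Record admissible (E : 'cV[R]_n.+1 -> 'M[R]_n.+1) : Prop := Admissible {
  admissible_unit : forall x, E x \in unitmx ;
  admissible_sym : forall x, (E x)^T = E x ;
  admissible_lipschitz : exists2 C : R, 0 < C &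
    forall x y, opnorm (E y - E x) <= C * enorm (y - x) ;
  admissible_lambda : exists2 a : R, 2^-1 < a &
    forall x, a <= lambda_min (E x) }.

End Exponent.

Definition borelRd (R : realType) (n : nat) :=
  g_sigma_algebraType (@open 'cV[R]_n.+1).

Section Sphere.
Context {R : realType} {n : nat}.

Record sphere :=
  Sphere { sphere_val : 'cV[R]_n.+1 ; sphereP : enorm sphere_val == 1 }.

Lemma enorm_delta : enorm (delta_mx 0 0 : 'cV[R]_n.+1) == 1.
Proof.
rewrite /enorm /dotp (bigD1 ord0) //= big1 ?mxE ?eqxx ?mulr1 ?addr0 ?sqrtr1 //.
by move=> i i0; rewrite !mxE (negbTE i0) mul0r.
Qed.

Lemma enormN (u : 'cV[R]_n.+1) : enorm (- u) = enorm u.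
Proof.
by rewrite /enorm /dotp; congr Num.sqrt; apply: eq_bigr => i _; rewrite !mxE mulrNN.
Qed.

HB.instance Definition _ := [isSub of sphere for sphere_val].
HB.instance Definition _ := [Choice of sphere by <:].
HB.instance Definition _ := isPointed.Build sphere (Sphere enorm_delta).

Lemma antipode_subproof (u : sphere) : enorm (- sphere_val u) == 1.
Proof. by rewrite enormN (sphereP u). Qed.

Definition antipode (u : sphere) : sphere := Sphere (antipode_subproof u).

(* The trace of the Borel sigma-algebra of R^d, that is, the Borel
   sigma-algebra of the sphere. *)
Definition borel_sphere := g_sigma_algebra_preimageType
  (fun u : sphere => sphere_val u : borelRd R n).

Definition symmetric_measure (sigma : set borel_sphere -> \bar R) : Prop :=
  forall A : set borel_sphere, measurable A -> sigma A = sigma (antipode @` A).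

End Sphere.
Arguments sphere : clear implicits.
Arguments borel_sphere : clear implicits.

Section ComplexIntegral.
Local Open Scope complex_scope.
Context {R : realType}.

Definition expC (z : R[i]) : R[i] :=
  (expR (complex.Re z))%:C *
    (cos (complex.Im z) +i* sin (complex.Im z)).

Definition Cintegral d (T : measurableType d) (mu : {measure set T -> \bar R})
    (D : set T) (f : T -> R[i]) : R[i] :=
  (\int[mu]_(t in D) complex.Re (f t)) +i*
  (\int[mu]_(t in D) complex.Im (f t)).

End ComplexIntegral.

Section Symbol.
Context {R : realType} {n : nat}.
Local Notation mu := (@lebesgue_measure R).
Variables (E : 'cV[R]_n.+1 -> 'M[R]_n.+1).
Variable sigma : {finite_measure set borel_sphere R n -> \bar R}.

(* The library integral applies to an arbitrary set function; only Borel sets A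
   that avoid 0 are relevant. *)
Definition levy (x : 'cV[R]_n.+1) (A : set (borelRd R n)) : \bar R :=
  (\int[sigma]_theta \int[mu]_(r in `]0%R, +oo[)
     ((\1_A (rpow r (E x) *m sphere_val theta) : R) / r ^+ 2)%:E)%E.

Local Open Scope complex_scope.

Definition symbol (x xi : 'cV[R]_n.+1) : R[i] :=
  Cintegral sigma setT (fun theta =>
    Cintegral mu `]0, +oo[ (fun r : R =>
      let iu := 0 +i* dotp (rpow r (E x) *m sphere_val theta) xi in
      (1 - expC iu + (\1_(`]0, 1[ : set R) r)%:C * iu) / (r ^+ 2)%:C)).

End Symbol.

(* Main.v *)
Require Import Defs.
From HB Require Import structures.
From mathcomp Require Import all_boot all_order all_algebra.
From mathcomp Require Import complex spectral ring lra.
From mathcomp Require Import all_classical all_reals all_analysis.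
From mathcomp Require Import measurable_realfun.

Import Order.TTheory GRing.Theory Num.Theory.
Import numFieldNormedType.Exports.
Import HBNNSimple.

Set Implicit Arguments.
Unset Strict Implicit.
Unset Printing Implicit Defensive.

Local Open Scope classical_set_scope.
Local Open Scope ring_scope.

(** Fix [x] and [xi] and write [s theta r] for the scalar product of
[r^(E x) theta] with [xi].  The integrand of the symbol has real part
[(1 - cos s) / r^2] and imaginary part [(1_(r < 1) s - sin s) / r^2].

The imaginary part is odd in [theta], because [s] is linear in [theta].  So is
its integral over [r], and the integral of an odd function against a measure
invariant under the antipode is zero ([Rintegral_odd]).

The real part is nonnegative, so its iterated integral makes sense in
[[0, +oo]], and its finiteness is what allows reading it as the real part of the
symbol.  Diagonalising the symmetric matrix [E x] with real eigenvalues [l m],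
the entries of [r^(E x)] are combinations of the powers [r^(l m)]
([symmetric_expE], [expmx_symmetric]), and all these eigenvalues are at least
some [a > 1/2].  Hence [|s theta r| <= C r^a] for [r <= 1], uniformly in
[theta] ([flow_small]).  From [1 - cos s <= min(s^2, 2)], the integrand is
dominated by [C^2 r^(2a - 2)] near [0], integrable since [2a - 2 > -1], and by
[2 r^-2] near infinity ([integral_levy_le]).

For the last integral, the Levy measure is the image under
[(theta, r) |-> r^(E x) theta] of the measure with density [r^-2 1_(r > 0)]
with respect to the product of [sigma] and the Lebesgue measure.  The
change-of-variables formula and the Tonelli theorem turn an integral against it
into an iterated integral over [theta] and [r] ([integral_levy]); this requires
the map to be measurable into the Borel sets of the Euclidean space, which is
checked on coordinates ([measurable_fun_colP]). *)

(** * Integration *)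

(** A set function is only evaluated on measurable sets by the integral, which
makes this usable when [m1] is not known to be a measure. *)
Lemma eq_integral_set_function d (T : measurableType d) (R : realType)
    (m1 m2 : set T -> \bar R) (D : set T) (f : T -> \bar R) :
  (forall A, measurable A -> m1 A = m2 A) ->
  (\int[m1]_(t in D) f t = \int[m2]_(t in D) f t)%E.
Proof.
move=> m12.
have simpleE g :
    [set sintegral m1 h | h in
      [set h : {nnsfun T >-> R} | forall x, ((h x)%:E <= g x)%E]] =
    [set sintegral m2 h | h in
      [set h : {nnsfun T >-> R} | forall x, ((h x)%:E <= g x)%E]].
  by apply: eq_imagel => h _; apply: eq_fsbigr => r _; rewrite m12.
by rewrite /integral !simpleE.
Qed.

Lemma fine_subC (R : realDomainType) (x y : \bar R) :
  fine (x - y)%E = - fine (y - x)%E.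
Proof. by move: x y => [x| |] [y| |] //=; rewrite ?oppr0// opprB. Qed.

(** With [P] and [N] the integrals of the positive and negative parts, this says
[fine (N - P) = - fine (P - N)].  When [P] or [N] is infinite, so are both
differences, and both sides are zero. *)
Lemma RintegralN d (T : measurableType d) (R : realType)
    (m : {measure set T -> \bar R}) (D : set T) (f : T -> R) :
  \int[m]_(t in D) (- f t) = - \int[m]_(t in D) f t.
Proof.
rewrite /Rintegral; under eq_integral do rewrite EFinN.
by rewrite integralE [in RHS]integralE fine_subC funeposN funenegN.
Qed.

(** The positive and the negative part of an odd function are exchanged by
[phi], so they have the same integral [P], and [fine (P - P) = 0] even if [P]
is infinite. *)
Lemma Rintegral_odd d (T : measurableType d) (R : realType)
    (m : {measure set T -> \bar R}) (phi : T -> T) (f : T -> R) :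
  measurable_fun setT phi -> measurable_fun setT f ->
  (forall A, measurable A -> m (phi @^-1` A) = m A) ->
  (forall t, f (phi t) = - f t) ->
  \int[m]_t f t = 0.
Proof.
move=> mphi mf mphiE fphi.
have mEf : measurable_fun setT (EFin \o f) by exact/measurable_EFinP.
have invariant (g : T -> \bar R) :
    measurable_fun setT g -> (forall t, (0 <= g t)%E) ->
    (\int[m]_t g t = \int[m]_t g (phi t))%E.
  move=> mg g0.
  rewrite -[RHS](@ge0_integral_pushforward _ _ _ _ _ _ mphi m setT g)//.
  by apply: eq_integral_set_function => A mA; rewrite /pushforward mphiE.
rewrite /Rintegral integralE.
have -> : (\int[m]_t (EFin \o f)^\+ t = \int[m]_t (EFin \o f)^\- t)%E.
  rewrite invariant//; last exact: measurable_funepos.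
  by apply: eq_integral => t _; rewrite funeposE funenegE/= fphi EFinN.
by case: (integral _ _ _) => //= r; rewrite subrr.
Qed.

Lemma measurable_fun_Rintegral2 d1 d2 (T1 : measurableType d1)
    (T2 : measurableType d2) (R : realType)
    (m : {sigma_finite_measure set T2 -> \bar R}) (f : T1 * T2 -> R) :
  measurable_fun setT f ->
  measurable_fun setT (fun x => \int[m]_y f (x, y)).
Proof.
move=> mf; have mEf : measurable_fun setT (EFin \o f) by exact/measurable_EFinP.
rewrite /Rintegral; under eq_fun do rewrite integralE.
apply: (measurableT_comp (fine_measurable measurableT)) => //.
apply: emeasurable_funB.
  have -> : (fun x => \int[m]_y (fun y => (f (x, y))%:E)^\+ y)%E =
      fubini_F m (EFin \o f)^\+%E.
    by apply/funext => x; apply: eq_integral => y _; rewrite !funeposE.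
  apply: measurable_fun_fubini_tonelli_F; last by move=> z; exact: funepos_ge0.
  exact: measurable_funepos.
have -> : (fun x => \int[m]_y (fun y => (f (x, y))%:E)^\- y)%E =
    fubini_F m (EFin \o f)^\-%E.
  by apply/funext => x; apply: eq_integral => y _; rewrite !funenegE.
apply: measurable_fun_fubini_tonelli_F; last by move=> z; exact: funeneg_ge0.
exact: measurable_funeneg.
Qed.

Lemma ge0_integral_bigcup_le d (T : measurableType d) (R : realType)
    (m : {measure set T -> \bar R}) (f : T -> \bar R) (F : nat -> set T)
    (M : \bar R) :
  nondecreasing_seq F -> (forall k, measurable (F k)) ->
  measurable_fun setT f -> (forall t, 0 <= f t)%E ->
  (forall k, \int[m]_(t in F k) f t <= M)%E ->
  (\int[m]_(t in \bigcup_k F k) f t <= M)%E.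
Proof.
move=> ndF mF mf f0 le.
have cv := @ge0_nondecreasing_set_cvg_integral _ _ _ F f m ndF mF
  (fun i => measurable_funS measurableT (@subsetT _ (F i)) mf)
  (fun i t _ => f0 t).
rewrite -(cvg_lim _ cv)//; apply: lime_le; last exact: nearW.
by apply/cvg_ex; eexists; exact: cv.
Qed.

Section density.
Local Open Scope ereal_scope.
Context d (T : measurableType d) (R : realType).
Variables (m : {measure set T -> \bar R}) (w : T -> R).

(** The two proofs are arguments so that the measure structure declared below
can be inferred from the term alone. *)
Definition density of measurable_fun [set: T] w & (forall t, (0 <= w t)%R) :=
  fun A : set T => \int[m]_(t in A) (w t)%:E.

Hypotheses (mw : measurable_fun [set: T] w) (w0 : forall t, (0 <= w t)%R).
Local Notation nu := (density mw w0).

Let density0 : nu set0 = 0. Proof. exact: integral_set0. Qed.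

Let density_ge0 A : 0 <= nu A.
Proof. by apply: integral_ge0 => t _; rewrite lee_fin. Qed.

Let density_sigma_additive : semi_sigma_additive nu.
Proof.
move=> F mF tF mUF; rewrite /density ge0_integral_bigcup//.
- by apply: is_cvg_nneseries => i _ _; exact: density_ge0.
- by apply/measurable_EFinP; exact: measurable_funS mw.
- by move=> t _; rewrite lee_fin.
Qed.

HB.instance Definition _ := isMeasure.Build _ _ _ nu
  density0 density_ge0 density_sigma_additive.

(** Linearity gives the formula for simple functions, and monotone convergence
on both sides extends it to nonnegative measurable ones. *)
Lemma ge0_integral_density (f : T -> \bar R) :
  measurable_fun [set: T] f -> (forall t, 0 <= f t) ->
  \int[nu]_t f t = \int[m]_t (f t * (w t)%:E).
Proof.
move=> mf f0.
have mEw : measurable_fun [set: T] (EFin \o w) by exact/measurable_EFinP.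
pose h := nnsfun_approx measurableT mf.
have hf t : EFin \o h^~ t @ \oo --> f t by exact: cvg_nnsfun_approx.
have ndh t : nondecreasing_seq (h^~ t).
  by move=> i j ij; exact/lefP/nd_nnsfun_approx.
have simple (g : {nnsfun T >-> R}) :
    \int[nu]_t (g t)%:E = \int[m]_t ((g t)%:E * (w t)%:E).
  transitivity (\sum_(y \in range g)
      \int[m]_t (y%:E * ((\1_(g @^-1` [set y]) t)%:E * (w t)%:E))).
    rewrite integralT_nnsfun sintegralE; apply: eq_fsbigr => y /[!inE] -[t _ <-].
    rewrite ge0_integralZl//; last 3 first.
    - by apply: emeasurable_funM => //; exact/measurable_EFinP.
    - by move=> s _; rewrite mule_ge0// lee_fin.
    - by rewrite lee_fin.
    congr (_ * _); rewrite [LHS]integral_mkcond; apply: eq_integral => s _.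
    by rewrite patchE indicE; case: ifPn => _; rewrite ?mul1e ?mul0e.
  rewrite -ge0_integral_fsum//; last 2 first.
  - move=> y; apply: measurable_funeM; apply: emeasurable_funM => //.
    exact/measurable_EFinP.
  - move=> y t _; rewrite muleA; apply: mule_ge0; last by rewrite lee_fin.
    exact: nnfun_muleindic_ge0.
  apply: eq_integral => t _; under eq_fsbigr do rewrite muleA.
  rewrite -ge0_mule_fsuml//; last by move=> y; exact: nnfun_muleindic_ge0.
  by rewrite fsumEFin// -fimfunE.
transitivity (limn (fun k => \int[nu]_t (h k t)%:E)).
  rewrite -monotone_convergence//.
  - by apply: eq_integral => t _; apply/esym/cvg_lim => //; exact: hf.
  - by move=> k; exact/measurable_EFinP.
  - by move=> k t _; rewrite lee_fin.
  - by move=> t _ i j ij; rewrite lee_fin ndh.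
under eq_fun do rewrite simple.
rewrite -monotone_convergence//.
- apply: eq_integral => t _; apply/cvg_lim => //.
  by apply: cvgeZr => //; exact: hf.
- by move=> k; apply: emeasurable_funM => //; exact/measurable_EFinP.
- by move=> k t _; rewrite mule_ge0// lee_fin.
- by move=> t _ i j ij; rewrite lee_wpmul2r ?lee_fin ?w0 ?ndh.
Qed.

End density.

(** * Borel sets of the Euclidean space and of the sphere *)

Section Borel.
Context {R : realType} {n : nat}.

Lemma measurable_coord (i : 'I_n.+1) :
  measurable_fun [set: borelRd R n]
    (fun u : borelRd R n => (u : 'cV[R]_n.+1) i 0).
Proof.
apply: (measurability _ (RGenOpens.measurableE R)).
move=> _ [_ [a [b ->] <-]]; rewrite setTI; apply: sub_sigma_algebra.
have /continuousP := @coord_continuous R n.+1 1 i 0.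
by apply; exact: interval_open.
Qed.

Lemma measurable_dotp (xi : 'cV[R]_n.+1) :
  measurable_fun [set: borelRd R n] (fun y : borelRd R n => dotp y xi).
Proof.
apply: measurable_sum => i; apply: measurable_funM => //.
exact: measurable_coord.
Qed.

(** The norm behind [ball] is the sup norm, so these balls are cubes with
rational centres: the union is countable, and membership in a cube is a
condition on each coordinate. *)
Lemma open_bigcup_rat_ball (U : set 'cV[R]_n.+1) : open U ->
  U = \bigcup_(qk in [set qk : 'cV[rat]_n.+1 * nat |
        ball (map_mx ratr qk.1 : 'cV[R]_n.+1) qk.2.+1%:R^-1 `<=` U])
      ball (map_mx ratr qk.1 : 'cV[R]_n.+1) qk.2.+1%:R^-1.
Proof.
move=> oU; apply/seteqP; split=> [x Ux|x [qk qkU]]; last exact: qkU.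
have /nbhs_ballP[_/posnumP[e] xeU] := open_nbhs_nbhs (conj oU Ux).
(* half of the radius, as a cube around a rational point close to [x] has to
   stay within [e] of [x] *)
have [k _ /(_ k (leqnn _))/= ke] :=
  near_infty_natSinv_lt (PosNum (divr_gt0 (gt0 e) (ltr0n R 2))).
have k0 : 0 < k.+1%:R^-1 :> R by rewrite invr_gt0 ltr0n.
have /choice[q qx] :
    forall i : 'I_n.+1, exists q : rat, `|x i 0 - ratr q| < k.+1%:R^-1.
  move=> i; have [|q] :=
      @rat_in_itvoo R (x i 0 - k.+1%:R^-1) (x i 0 + k.+1%:R^-1).
    by rewrite ltrD2l gtrN.
  by rewrite in_itv/= => qx; exists q; rewrite distrC ltr_distl.
exists (\col_i q i, k); last first.
  by split=> // i j; rewrite !mxE (ord1 j) /ball/= distrC.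
move=> y [_ qy]; apply: xeU; split=> // i j; rewrite (ord1 j).
have := qy i 0; rewrite !mxE /ball/= => {}qy.
rewrite -(subrK (ratr (q i)) (x i 0)) -addrA (le_lt_trans (ler_normD _ _))//.
by rewrite [ltRHS]splitr ltrD// (lt_trans _ ke).
Qed.

Lemma measurable_fun_colP d (T : measurableType d) (f : T -> borelRd R n) :
  (forall i, measurable_fun setT (fun t => (f t : 'cV[R]_n.+1) i 0)) ->
  measurable_fun setT f.
Proof.
move=> mf.
apply: (@measurability _ _ _ (borelRd R n) setT f (@open _) erefl).
move=> _ [U oU <-].
rewrite setTI (open_bigcup_rat_ball oU) preimage_bigcup bigcup_mkcond.
apply: countable_bigcupT_measurable => [|[q k]]; first exact: countableP.
case: ifPn => // _.
rewrite (_ : _ @^-1` _ = \bigcap_(i in [set: 'I_n.+1])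
   ((fun t => (f t : 'cV[R]_n.+1) i 0) @^-1`
     ball (ratr (q i 0) : R) k.+1%:R^-1)).
  apply: fin_bigcap_measurable => // i _; rewrite -[X in measurable X]setTI.
  by apply: mf => //; exact: measurable_ball.
apply/seteqP; split=> t /=.
  by move=> [_ tq] i _ /=; have := tq i 0; rewrite mxE.
move=> tq; split; first by rewrite invr_gt0 ltr0n.
by move=> i j; rewrite !mxE (ord1 j); exact: tq.
Qed.

Lemma measurable_sphere_val :
  measurable_fun [set: borel_sphere R n]
    (fun u : borel_sphere R n => sphere_val u : borelRd R n).
Proof. by move=> _ B mB; exists B. Qed.

Lemma measurable_antipode :
  measurable_fun [set: borel_sphere R n]
    (antipode : borel_sphere R n -> borel_sphere R n).
Proof.
have mN : measurable_fun setT
    (fun u : borel_sphere R n => sphere_val (antipode u) : borelRd R n).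
  apply: measurable_fun_colP => i.
  have -> : (fun u : borel_sphere R n => sphere_val (antipode u) i 0) =
      (fun u => - sphere_val u i 0) by apply/funext => u; rewrite mxE.
  apply: measurableT_comp => //.
  by apply: (measurableT_comp (measurable_coord i)); exact: measurable_sphere_val.
move=> _ _ [B mB <-]; rewrite !setTI.
by have := mN measurableT B mB; rewrite setTI.
Qed.

(** [symmetric_measure] speaks of images; the antipode being an involution,
they are also preimages, the form in which image measures are written. *)
Lemma symmetric_measure_preimage
    (sigma : {measure set (borel_sphere R n) -> \bar R})
    (A : set (borel_sphere R n)) :
  symmetric_measure sigma -> measurable A ->
  sigma (antipode @^-1` A) = sigma A.
Proof.
move=> sym mA; rewrite [RHS]sym//; congr (sigma _).
have antipodeK : involutive (@antipode R n).
  by move=> u; apply: val_inj; rewrite /= opprK.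
apply/seteqP; split=> [u Au|_ [u Au <-]]; last by rewrite /preimage/= antipodeK.
by exists (antipode u); rewrite ?antipodeK.
Qed.

Lemma sphere_coord_le1 (theta : sphere R n) i : `|sphere_val theta i 0| <= 1.
Proof.
have /eqP d1 := sphereP theta.
rewrite -(@ler_pXn2r _ 2)// ?nnegrE// expr1n real_normK ?num_real//.
have -> : (1 : R) = dotp (sphere_val theta) (sphere_val theta).
  rewrite -(expr1n _ 2) -d1 sqr_sqrtr//; apply: sumr_ge0 => j _.
  by rewrite -expr2 sqr_ge0.
rewrite /dotp (bigD1 i)//= -expr2 lerDl.
by apply: sumr_ge0 => j _; rewrite -expr2 sqr_ge0.
Qed.

Lemma dotpNl (u v : 'cV[R]_n.+1) : dotp (- u) v = - dotp u v.
Proof. by rewrite /dotp -sumrN; apply: eq_bigr => i _; rewrite mxE mulNr. Qed.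

End Borel.

(** * The exponential of a real symmetric matrix *)

Section Spectral.
Local Open Scope complex_scope.
Context {R : realType} {n : nat}.
Implicit Types A : 'M[R]_n.+1.

(** The spectral theorem for [A], carried back to the reals.  The matrix [c m]
is the real part of the rank-one matrix attached to the [m]-th vector of a
unitary eigenbasis; since the eigenvalues are real, taking real parts in
[A ^+ k = P^-1 D^k P] costs nothing. *)
Lemma symmetric_expE A : A^T = A ->
  exists (l : 'I_n.+1 -> R) (c : 'I_n.+1 -> 'M[R]_n.+1),
    (forall m, eigenvalue (map_mx (real_complex R) A) (l m)%:C) /\
    forall k, A ^+ k = \sum_m l m ^+ k *: c m.
Proof.
move=> symA; set AC := map_mx _ A.
have realAC : AC \is a realmx.
  by apply/mxOverP => i j; rewrite mxE complex_real.
have symAC : AC \is symmetricmx.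
  by apply/is_hermitianmxP; rewrite expr0 scale1r map_mx_id// /AC map_trmx symA.
have hermAC : AC \is hermsymmx by exact: realsym_hermsym.
have /mxOverP realD := hermitian_spectral_diag_real hermAC.
have /orthomx_spectralP := hermitian_normalmx hermAC.
set P := spectralmx AC; set D := spectral_diag AC => ACE.
have Punit : P \in unitmx by exact: spectral_unit.
pose l m : R := complex.Re (D 0 m).
have lE m : (l m)%:C = D 0 m by rewrite RRe_real// realD.
exists l, (fun m => \matrix_(i, j) complex.Re (invmx P i m * P m j)).
split=> [m|k].
  (* the eigenvector is the [m]-th row of [P], as matrices act on row vectors *)
  apply/eigenvalueP; exists (row m P).
    rewrite -row_mul {1}ACE !mulmxA mulmxV// mul1mx lE.
    by rewrite row_mul row_diag_mx -scalemxAl -rowE.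
  apply: contraNneq (oner_neq0 R[i]) => /(congr1 (fun v => (v *m invmx P) 0 m)).
  by rewrite -row_mul mulmxV// mul0mx !mxE eqxx => <-.
have ACk : AC ^+ k = invmx P *m diag_mx (\row_m D 0 m ^+ k) *m P.
  elim: k => [|k IH].
    rewrite expr0 (_ : diag_mx _ = 1%:M) ?mulmx1 ?mulVmx//.
    by apply/matrixP => i j; rewrite !mxE expr0.
  rewrite exprS IH {1}ACE [_ * _]mulmxA -!(mulmxA (invmx P)); congr (_ *m _).
  rewrite -!mulmxA mulKVmx// !mulmxA mulmx_diag; congr (diag_mx _ *m _).
  by apply/rowP => m; rewrite !mxE exprS.
apply/matrixP => i j; rewrite summxE.
have -> : (A ^+ k) i j = complex.Re ((AC ^+ k) i j).
  by rewrite /AC -rmorphXn mxE.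
rewrite ACk mxE raddf_sum; apply: eq_bigr => m _.
rewrite mul_mx_diag !mxE mulrAC -lE -rmorphXn/=.
by case: (_ * P m j) => u v /=; rewrite mulr0 subr0 mulrC.
Qed.

(** An infimum is a lower bound only for sets bounded below; here the
eigenvalues are among the finitely many roots of the characteristic
polynomial. *)
Lemma lambda_min_le A (l : R) :
  eigenvalue (map_mx (real_complex R) A) l%:C -> lambda_min A <= l.
Proof.
move=> Al; apply: ge_inf; last by exists l%:C.
have [rs charE] :=
  closed_field_poly_normal (char_poly (map_mx (real_complex R) A)).
exists (- \sum_(z <- rs) `|complex.Re z|) => _ [z Az <-].
move: Az => /=; rewrite eigenvalue_root_char charE.
rewrite (monicP (char_poly_monic _)) scale1r root_prod_XsubC => zrs.
rewrite lerNl (big_rem z zrs)/= (le_trans (ler_norm _))// normrN lerDl.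
exact: sumr_ge0.
Qed.

(** The exponential series of [s *: A] is a finite combination of scalar
exponential series, and inherits its convergence from them. *)
Lemma expmx_symmetric A (l : 'I_n.+1 -> R) (c : 'I_n.+1 -> 'M[R]_n.+1) :
  (forall k, A ^+ k = \sum_m l m ^+ k *: c m) ->
  forall s, expmx (s *: A) = \sum_m expR (s * l m) *: c m.
Proof.
move=> AE s; have termE : (fun k => k`!%:R^-1 *: (s *: A) ^+ k) =
    fun k => \sum_m exp_coeff (s * l m) k *: c m.
  apply/funext => k; apply/matrixP => i j.
  rewrite exprZn AE !mxE !summxE !mulr_sumr.
  apply: eq_bigr => m _; rewrite !mxE !mulrA /exp_coeff/= exprMn.
  by congr (_ * _); rewrite -mulrA mulrC.
rewrite /expmx termE; apply/cvg_lim => //.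
rewrite [X in X @ _ --> _](_ : _ =
    fun N => \sum_m series (exp_coeff (s * l m)) N *: c m).
  apply: cvg_big => [|m _]; first exact: add_continuous.
  by apply: cvgZr_tmp; exact: is_cvg_series_exp_coeff.
apply/funext => N; rewrite /series/= exchange_big/=.
by apply: eq_bigr => m _; rewrite scaler_suml.
Qed.

(** This also holds at [r <= 0], where [ln r = 0]: the joint measurability in
[r] below is obtained without restricting [r]. *)
Lemma rpow_symmetric A (l : 'I_n.+1 -> R) (c : 'I_n.+1 -> 'M[R]_n.+1) :
  (forall k, A ^+ k = \sum_m l m ^+ k *: c m) ->
  forall r i j, rpow r A i j = \sum_m expR (ln r * l m) * c m i j.
Proof.
move=> AE r i j; rewrite /rpow (expmx_symmetric AE) summxE.
by apply: eq_bigr => m _; rewrite mxE.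
Qed.

End Spectral.

(** * Integrals on the half-line *)

Section HalfLine.
Context {R : realType}.
Local Notation mu := (@lebesgue_measure R).

Lemma measurable_cos : measurable_fun [set: R] cos.
Proof. by apply: continuous_measurable_fun; exact: continuous_cos. Qed.

Lemma measurable_sin : measurable_fun [set: R] sin.
Proof. by apply: continuous_measurable_fun; exact: continuous_sin. Qed.

Lemma norm_sin_le (x : R) : `|sin x| <= `|x|.
Proof.
wlog x0 : x / 0 <= x => [wlg|].
  have [x0|/ltW x0] := leP 0 x; first exact: wlg.
  by have := wlg (- x); rewrite sinN !normrN oppr_ge0; exact.
move: x0; rewrite le_eqVlt => /predU1P[<-|x0]; first by rewrite sin0.
have [y _] := MVT x0 (fun y _ => is_derive_sin y)
  (continuous_subspaceT (@continuous_sin R)).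
by rewrite sin0 !subr0 => ->; rewrite normrM ler_piMl// cos_max.
Qed.

Lemma one_sub_cos_le_sqr (x : R) : 1 - cos x <= x ^+ 2.
Proof.
have -> : 1 - cos x = sin (x / 2) ^+ 2 *+ 2.
  by rewrite [in LHS](splitr x) -mulr2n cos_mulr2n cos2sin2; ring.
have : sin (x / 2) ^+ 2 <= (x / 2) ^+ 2.
  rewrite -(real_normK (num_real (sin _))) -(real_normK (num_real (x / 2))).
  by rewrite lerXn2r// ?nnegrE// norm_sin_le.
have := sqr_ge0 x; nra.
Qed.

Lemma integral_powR_itv (p x y : R) : p + 1 != 0 -> 0 < x -> x < y ->
  (\int[mu]_(r in `[x, y]) (r `^ p)%:E =
    ((y `^ (p + 1) - x `^ (p + 1)) / (p + 1))%:E)%E.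
Proof.
move=> p0 x0 xy.
have pos (r : R) : r \in `[x, y] -> 0 < r.
  by rewrite in_itv/= => /andP[xr _]; exact: lt_le_trans xr.
have cont q (r : R) : 0 < r -> {for r, continuous (fun r : R => r `^ q)}.
  move=> r0; apply: differentiable_continuous; apply/derivable1_diffP.
  by have [] := is_derive1_powR q r0.
pose F (r : R) := (p + 1)^-1 * r `^ (p + 1).
have dF (r : R) : 0 < r -> is_derive r 1 F (r `^ p).
  move=> r0; have -> : r `^ p = (p + 1)^-1 *: ((p + 1) * r `^ (p + 1 - 1)).
    by rewrite addrK /GRing.scale/= mulKf.
  exact: (is_deriveZ (p + 1)^-1 (is_derive1_powR (p + 1) r0)).
have cF (r : R) : 0 < r -> {for r, continuous F}.
  move=> r0; apply: differentiable_continuous; apply/derivable1_diffP.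
  by have [] := dF r r0.
rewrite (@continuous_FTC2 _ _ F)//.
- by rewrite -EFinB /F -mulrBr mulrC.
- by apply: continuous_in_subspaceT => r; rewrite inE/= => /pos; exact: cont.
- split.
  + move=> r; rewrite in_itv/= => /andP[xr _].
    by have [] := dF r (lt_trans x0 xr).
  + exact/cvg_at_right_filter/cF.
  + by apply/cvg_at_left_filter/cF; exact: lt_trans xy.
- move=> r; rewrite in_itv/= => /andP[xr _].
  by rewrite derive1E; have [_ ->] := dF r (lt_trans x0 xr).
Qed.

(** For [p < 0] the integrand is unbounded at [0], out of reach of the
fundamental theorem of calculus on [[0, 1]]; the segments [[1 / (k + 2), 1]]
exhaust the domain instead. *)
Lemma integral_powR_near0 (p : R) : -1 < p ->
  (\int[mu]_(r in `]0%R, 1%R]) (r `^ p)%:E <= ((p + 1)^-1)%:E)%E.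
Proof.
move=> p1; have p0 : 0 < p + 1 by rewrite -ltrBlDr sub0r.
have -> : `]0, 1]%classic = \bigcup_k `[k.+2%:R^-1, 1%R]%classic :> set R.
  apply/seteqP; split=> [r/=|r [k _]]/=; rewrite !in_itv/=.
    move=> /andP[r0 r1].
    have [k _ /(_ k (leqnn _))/= kr] := near_infty_natSinv_lt (PosNum r0).
    exists k => //=; rewrite in_itv/= r1 andbT (le_trans _ (ltW kr))//.
    by rewrite lef_pV2 ?posrE ?ltr0n// ler_nat.
  by move=> /andP[kr ->]; rewrite andbT (lt_le_trans _ kr)// invr_gt0 ltr0n.
apply: ge0_integral_bigcup_le => //.
- move=> k m km; rewrite subsetEset => r/=; rewrite !in_itv/= => /andP[kr ->].
  by rewrite andbT (le_trans _ kr)// lef_pV2 ?posrE ?ltr0n// ler_nat.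
- exact: measurableT_comp.
- by move=> r; rewrite lee_fin powR_ge0.
move=> k; rewrite integral_powR_itv ?gt_eqF//.
  by rewrite lee_fin powR1/= ler_piMl ?invr_ge0 ?(ltW p0)// gerBl powR_ge0.
by rewrite invf_lt1 ?ltr0n// ltr1n.
Qed.

Lemma integral_powR_infty (p : R) : p < -1 ->
  (\int[mu]_(r in `[1%R, +oo[) (r `^ p)%:E <= (- (p + 1)^-1)%:E)%E.
Proof.
move=> p1; have p0 : p + 1 < 0 by rewrite -ltrBrDr sub0r.
have -> : `[1, +oo[%classic = \bigcup_k `[1%R, k.+2%:R]%classic :> set R.
  apply/seteqP; split=> [r/=|r [k _]]/=; rewrite !in_itv/=; last by case/andP => ->.
  rewrite andbT => r1; exists (Num.trunc r) => //=.
  by rewrite in_itv/= r1 (le_trans (ltW (truncnS_gt r)))// ler_nat.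
apply: ge0_integral_bigcup_le => //.
- move=> k m km; rewrite subsetEset => r/=; rewrite !in_itv/= => /andP[-> rk].
  by rewrite (le_trans rk)// ler_nat.
- exact: measurableT_comp.
- by move=> r; rewrite lee_fin powR_ge0.
move=> k; rewrite integral_powR_itv ?lt_eqF// ?ltr1n//.
rewrite lee_fin powR1/= -[leLHS]mulrNN opprB ler_piMl//.
by rewrite oppr_ge0 invr_le0 ltW.
Qed.

(** The hypothesis [1/2 < a] is exactly integrability of [r^(2a - 2)] at [0].
The bound depends on [s] only through [C] and [a], which makes it uniform over
the sphere. *)
Lemma integral_levy_le (s : R -> R) (C a : R) : 2^-1 < a ->
  measurable_fun [set: R] s ->
  (forall r, 0 < r <= 1 -> `|s r| <= C * r `^ a) ->
  (\int[mu]_(r in `]0%R, +oo[) ((1 - cos (s r)) / r ^+ 2)%:E <=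
    (C ^+ 2 / (2 * a - 1) + 2)%:E)%E.
Proof.
move=> a2 ms sC.
have f0 r : 0 <= (1 - cos (s r)) / r ^+ 2.
  by rewrite divr_ge0 ?sqr_ge0// subr_ge0 cos_le1.
have rE r : 0 < r -> (r ^+ 2)^-1 = r `^ (- 2).
  by move=> r0; rewrite powR_invn// ltW.
have mf (D : set (measurableTypeR R)) : measurable D -> D `<=` `]0, +oo[ ->
    measurable_fun D (fun r => ((1 - cos (s r)) / r ^+ 2)%:E).
  move=> mD D0; apply/measurable_EFinP.
  apply: (eq_measurable_fun (fun r => (1 - cos (s r)) * r `^ (- 2))).
    by move=> r /[!inE] /D0/=; rewrite in_itv/= andbT => /rE ->.
  apply: measurable_funTS; apply: measurable_funM => //.
  by apply: measurable_funB => //; exact: (measurableT_comp measurable_cos).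
have -> : `]0%R, +oo[%classic = `]0, 1] `|` `]1, +oo[ :> set R.
  by rewrite -itv_bndbnd_setU// bnd_simp.
rewrite ge0_integral_setU//; last 3 first.
- apply: mf; first exact: measurableU.
  by move=> r /= [|]; rewrite !in_itv/= ?andbT; [case/andP|exact: lt_trans].
- by move=> r _; rewrite lee_fin.
- apply/disj_set2P; rewrite -subset0 => r/= []; rewrite !in_itv/= andbT.
  by move=> /andP[_ r1]; rewrite ltNge r1.
rewrite EFinD leeD//.
- apply: (@le_trans _ _
    (\int[mu]_(r in `]0%R, 1%R]) (C ^+ 2 * r `^ (2 * a - 2))%:E)%E).
    apply: ge0_le_integral => //=.
    + by move=> r _; rewrite lee_fin.
    + by apply: mf => // r/=; rewrite !in_itv/= andbT => /andP[].
    + by apply/measurable_EFinP; apply: measurable_funTS; exact: measurable_funM.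
    move=> r; rewrite in_itv/= => r01; have /andP[r0 r1] := r01.
    have powE : r `^ (2 * a - 2) = r `^ (2 * a) * r `^ (- 2).
      by rewrite powRD// (gt_eqF r0) implybT.
    rewrite lee_fin rE// powE mulrA ler_wpM2r ?powR_ge0//.
    rewrite (le_trans (one_sub_cos_le_sqr _))//.
    rewrite -real_normK ?num_real// [2 * a]mulrC powRrM powR_mulrn ?powR_ge0//.
    by rewrite -exprMn lerXn2r ?nnegrE ?sC// (le_trans _ (sC r r01)).
  under eq_integral do rewrite EFinM.
  rewrite ge0_integralZl//=.
  + rewrite [leRHS]EFinM lee_wpmul2l ?lee_fin ?sqr_ge0//.
    rewrite (le_trans (integral_powR_near0 _))//; first lra.
    by rewrite lee_fin (_ : 2 * a - 2 + 1 = 2 * a - 1)//; ring.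
  + by apply/measurable_EFinP; exact: measurable_funTS.
  + by move=> r _; rewrite lee_fin powR_ge0.
  + by rewrite lee_fin sqr_ge0.
- apply: (@le_trans _ _ (\int[mu]_(r in `]1%R, +oo[) (2 * r `^ (- 2))%:E)%E).
    apply: ge0_le_integral => //=.
    + by move=> r _; rewrite lee_fin.
    + by apply: mf => // r/=; rewrite !in_itv/= !andbT; exact: lt_trans.
    + by apply/measurable_EFinP; apply: measurable_funTS; exact: measurable_funM.
    move=> r; rewrite in_itv/= andbT => r1.
    rewrite lee_fin rE ?(lt_trans _ r1)// ler_wpM2r ?powR_ge0//.
    by rewrite lerBlDr -lerBlDl; have := cos_geN1 (s r); lra.
  under eq_integral do rewrite EFinM.
  rewrite ge0_integralZl//=.
  + rewrite -[leRHS]mule1 lee_wpmul2l ?lee_fin//.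
    rewrite integral_itv_obnd_cbnd; last first.
      by apply/measurable_EFinP; exact: measurable_funTS.
    have m21 : - 2 < -1 :> R by lra.
    apply: (le_trans (integral_powR_infty m21)).
    by rewrite lee_fin (_ : - 2 + 1 = -1) ?invrN1 ?opprK//; ring.
  + by apply/measurable_EFinP; exact: measurable_funTS.
  + by move=> r _; rewrite lee_fin powR_ge0.
Qed.

Definition invsq_weight (r : R) : R := \1_(`]0, +oo[ : set R) r / r ^+ 2.

Lemma invsq_weight_ge0 r : 0 <= invsq_weight r.
Proof. by rewrite divr_ge0 ?sqr_ge0. Qed.

Lemma measurable_invsq_weight : measurable_fun [set: R] invsq_weight.
Proof.
rewrite (_ : invsq_weight = fun r => \1_(`]0, +oo[ : set R) r * r `^ (- 2)).
  by apply: measurable_funM => //; exact: measurable_indic.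
apply/funext => r; rewrite /invsq_weight indicE.
case: (boolP (_ \in _)) => [|_]; last by rewrite !mul0r.
by rewrite inE/= in_itv/= andbT => r0; rewrite powR_invn// ltW.
Qed.

(** Moving the domain into the weight gives integrals over whole spaces, the
form to which the Tonelli theorem applies. *)
Lemma integral_invsq (f : R -> R) :
  (\int[mu]_(r in `]0%R, +oo[) (f r / r ^+ 2)%:E =
   \int[mu]_r (f r * invsq_weight r)%:E)%E.
Proof.
rewrite integral_mkcond; apply: eq_integral => r _.
rewrite patchE /invsq_weight indicE; case: ifPn => _; first by rewrite mul1r.
by rewrite mul0r mulr0.
Qed.

Lemma Rintegral_invsq (f : R -> R) :
  \int[mu]_(r in `]0, +oo[) (f r / r ^+ 2) = \int[mu]_r (f r * invsq_weight r).
Proof. by rewrite /Rintegral integral_invsq. Qed.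

End HalfLine.

(** * The Levy measure as an image measure *)

Section Levy.
Context {R : realType} {n : nat}.
Local Notation mu := (@lebesgue_measure R).
Implicit Types A : 'M[R]_n.+1.

Definition flow A (z : borel_sphere R n * R) : borelRd R n :=
  rpow z.2 A *m sphere_val z.1.

Lemma flow_antipode A theta r : flow A (antipode theta, r) = - flow A (theta, r).
Proof. by rewrite /flow/= mulmxN. Qed.

Lemma measurable_flow A : A^T = A ->
  measurable_fun [set: borel_sphere R n * measurableTypeR R] (flow A).
Proof.
move=> /symmetric_expE[l [c [_ AE]]].
apply: measurable_fun_colP => i.
have -> : (fun z => (flow A z : 'cV_n.+1) i 0) = (fun z => \sum_j
    (\sum_m expR (ln z.2 * l m) * c m i j) * sphere_val z.1 j 0).
  apply/funext => z; rewrite mxE; apply: eq_bigr => j _.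
  by rewrite (rpow_symmetric AE).
apply: measurable_sum => j; apply: measurable_funM.
  apply: measurable_sum => m; apply: measurable_funM => //.
  apply: measurableT_comp => //; apply: measurable_funM => //.
  by apply: measurableT_comp => //; exact: measurable_snd.
apply: (measurableT_comp (measurable_coord j)).
by apply: (measurableT_comp measurable_sphere_val); exact: measurable_fst.
Qed.

(** For [r <= 1], [a <= l m] gives [r^(l m) <= r^a], and the coordinates of a unit
vector are bounded by [1], so the sum of the absolute values of all the
coefficients is a uniform constant. *)
Lemma flow_small A (a : R) (xi : 'cV[R]_n.+1) : A^T = A -> a <= lambda_min A ->
  exists C, forall theta r, 0 < r <= 1 ->
    `|dotp (flow A (theta, r)) xi| <= C * r `^ a.
Proof.
move=> symA aA; have [l [c [eigl AE]]] := symmetric_expE symA.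
exists (\sum_i (\sum_j \sum_m `|c m i j|) * `|xi i 0|) => theta r /andP[r0 r1].
rewrite /dotp mulr_suml (le_trans (ler_norm_sum _ _ _))// ler_sum// => i _.
rewrite normrM mxE [leRHS]mulrAC ler_wpM2r//.
rewrite mulr_suml (le_trans (ler_norm_sum _ _ _))// ler_sum// => j _.
rewrite normrM (le_trans (ler_piMr _ (sphere_coord_le1 _ _)))//=.
rewrite (rpow_symmetric AE) mulr_suml (le_trans (ler_norm_sum _ _ _))//.
apply: ler_sum => m _.
rewrite normrM mulrC ler_wpM2l// ger0_norm ?expR_ge0//.
rewrite /powR gt_eqF// ler_expR mulrC ler_wnM2r ?ln_le0//.
exact: le_trans (lambda_min_le (eigl m)).
Qed.

(** [levy] is a bare set function, so it is first identified, on Borel sets,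
with the image under [flow] of the measure of density [r^-2] on [r > 0].  As
[f] vanishes at the origin, the restriction to the complement of [0] can be
dropped. *)
Lemma integral_levy (E : 'cV[R]_n.+1 -> 'M[R]_n.+1)
    (sigma : {finite_measure set (borel_sphere R n) -> \bar R})
    (x : 'cV[R]_n.+1) (f : borelRd R n -> R) :
  (E x)^T = E x ->
  measurable_fun setT f -> (forall y, 0 <= f y) -> f (0 : 'cV[R]_n.+1) = 0 ->
  (\int[levy E sigma x]_(y in ~` [set 0%R]) (f y)%:E =
   \int[sigma]_theta \int[mu]_(r in `]0%R, +oo[)
      (f (flow (E x) (theta, r)) / r ^+ 2)%:E)%E.
Proof.
move=> symE mf f0 f00; have mflow := measurable_flow symE.
have mw : measurable_fun [set: borel_sphere R n * measurableTypeR R]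
    (invsq_weight \o snd).
  exact: measurableT_comp measurable_invsq_weight _.
have w0 z :
    0 <= (invsq_weight \o snd : borel_sphere R n * measurableTypeR R -> R) z.
  exact: invsq_weight_ge0.
pose nu := density (sigma \x mu)%E mw w0.
have tonelli (g : borelRd R n -> R) :
    measurable_fun setT g -> (forall y, 0 <= g y) ->
    (\int[(sigma \x mu)%E]_z
       ((g (flow (E x) z))%:E * (invsq_weight z.2)%:E) =
     \int[sigma]_theta \int[mu]_(r in `]0%R, +oo[)
       (g (flow (E x) (theta, r)) / r ^+ 2)%:E)%E.
  move=> mg g0; rewrite fubini_tonelli1//=.
  - by apply: eq_integral => theta _; rewrite integral_invsq.
  - apply: emeasurable_funM; apply/measurable_EFinP => //.
    exact: measurableT_comp mg mflow.
  - by move=> z; rewrite mule_ge0// lee_fin// invsq_weight_ge0.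
have levyE (B : set (borelRd R n)) :
    measurable B -> levy E sigma x B = pushforward nu (flow (E x)) B.
  move=> mB; rewrite /levy -(tonelli \1_B)//.
  rewrite /pushforward /nu /density [RHS]integral_mkcond.
  apply: eq_integral => z _; rewrite patchE indicE.
  rewrite (_ : (_ \in _) = (z \in flow (E x) @^-1` B)) ?mem_preimage//.
  by case: ifP; rewrite ?mul1e ?mul0e.
rewrite (eq_integral_set_function _ _ levyE) integral_mkcond.
rewrite (_ : _ \_ _ = EFin \o f); last first.
  apply/funext => y; rewrite patchE; case: ifPn => //.
  by rewrite notin_setE => /contrapT ->; rewrite /= f00.
rewrite ge0_integral_pushforward//.
- rewrite preimage_setT ge0_integral_density//.
  + exact: tonelli.
  + by apply: measurableT_comp => //; apply/measurable_EFinP.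
  + by move=> z; rewrite lee_fin.
- exact/measurable_EFinP.
- by move=> y _; rewrite lee_fin.
Qed.

End Levy.

(** * The symbol *)

Section Integrand.
Local Open Scope complex_scope.

Lemma symbol_integrandE (R : realType) (s b r : R) :
  let iu := 0 +i* s in
  (1 - expC iu + b%:C * iu) / (r ^+ 2)%:C =
  ((1 - cos s) / r ^+ 2) +i* ((b * s - sin s) / r ^+ 2).
Proof.
rewrite /= /expC/= expR0 -fmorphV/=.
by apply/eqP; rewrite eq_complex/=; apply/andP; split; apply/eqP; ring.
Qed.

End Integrand.

Theorem theorem2p17 (R : realType) (n : nat)
    (E : 'cV[R]_n.+1 -> 'M[R]_n.+1)
    (sigma : {finite_measure set (borel_sphere R n) -> \bar R}) :
  admissible E ->
  symmetric_measure sigma ->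
  forall x xi : 'cV[R]_n.+1, exists c : R,
    [/\ symbol E sigma x xi = (c%:C)%C,
        (\int[sigma]_theta \int[@lebesgue_measure R]_(r in `]0%R, +oo[)
           ((1 - cos (dotp (rpow r (E x) *m sphere_val theta) xi)) / r ^+ 2)%:E)%E
        = c%:E
      & (\int[levy E sigma x]_(y in ~` [set 0%R])
           (1 - cos (dotp y xi))%:E)%E = c%:E].
Proof.
move=> [_ symE _ [a a2 aE]] sym_sigma x xi.
pose s theta r := dotp (flow (E x) (theta, r)) xi.
have ms : measurable_fun [set: borel_sphere R n * measurableTypeR R]
    (fun z => s z.1 z.2).
  rewrite (_ : (fun z => s z.1 z.2) = (fun y => dotp y xi) \o flow (E x)).
    exact: measurableT_comp (measurable_dotp xi) (measurable_flow (symE x)).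
  by apply/funext => -[].
have sN theta r : s (antipode theta) r = - s theta r.
  by rewrite /s flow_antipode dotpNl.
have [C sC] := flow_small xi (symE x) (aE x).
pose I theta := (\int[@lebesgue_measure R]_(r in `]0%R, +oo[)
  ((1 - cos (s theta r)) / r ^+ 2)%:E)%E.
pose M := C ^+ 2 / (2 * a - 1) + 2.
have I0 theta : (0 <= I theta)%E.
  apply: integral_ge0 => r _.
  by rewrite lee_fin divr_ge0 ?sqr_ge0// subr_ge0 cos_le1.
have IM theta : (I theta <= M%:E)%E.
  apply: integral_levy_le a2 _ (sC theta).
  exact: measurableT_comp ms (pair1_measurable theta).
have Ifin theta : I theta \is a fin_num.
  by rewrite ge0_fin_numE// (le_lt_trans (IM theta)) ?ltry.
have mI : measurable_fun [set: borel_sphere R n] I.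
  rewrite (_ : I = fun theta => \int[@lebesgue_measure R]_r
      ((1 - cos (s theta r)) * invsq_weight r)%:E)%E; last first.
    by apply/funext => theta; exact: integral_invsq.
  apply: (measurable_fun_fubini_tonelli_F
    (fun z : borel_sphere R n * measurableTypeR R =>
      ((1 - cos (s z.1 z.2)) * invsq_weight z.2)%:E)).
    apply/measurable_EFinP; apply: measurable_funM.
      by apply: measurable_funB => //; exact: measurableT_comp measurable_cos ms.
    exact: measurableT_comp measurable_invsq_weight measurable_snd.
  by move=> z; rewrite lee_fin mulr_ge0 ?invsq_weight_ge0// subr_ge0 cos_le1.
have intI_fin : (\int[sigma]_theta I theta)%E \is a fin_num.
  rewrite ge0_fin_numE; last by apply: integral_ge0 => theta _.
  apply: (@le_lt_trans _ _ (\int[sigma]_theta (cst M%:E theta))%E).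
    exact: ge0_le_integral.
  rewrite integral_cst// lte_mul_pinfty ?fin_num_fun_lty//.
  exact: le_trans (I0 point) (IM point).
exists (fine (\int[sigma]_theta I theta)%E); split.
- rewrite /symbol.
  under [X in Cintegral _ _ X]eq_fun do
    under [X in Cintegral _ _ X]eq_fun do rewrite symbol_integrandE.
  apply/eqP; rewrite eq_complex/=; apply/andP; split; apply/eqP.
    by congr fine; apply: eq_integral => theta _; rewrite -[RHS]fineK.
  pose h theta r := \1_(`]0, 1[ : set R) r * s theta r - sin (s theta r).
  apply: (@Rintegral_odd _ _ _ sigma antipode
    (fun theta =>
      \int[@lebesgue_measure R]_(r in `]0, +oo[) (h theta r / r ^+ 2))).
  + exact: measurable_antipode.
  + rewrite (_ : (fun theta => _) = fun theta =>
        \int[@lebesgue_measure R]_r (h theta r * invsq_weight r)); last first.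
      by apply/funext => theta; exact: Rintegral_invsq.
    apply: (@measurable_fun_Rintegral2 _ _ _ _ _ (@lebesgue_measure R)
      (fun z : borel_sphere R n * measurableTypeR R =>
        h z.1 z.2 * invsq_weight z.2)).
    apply: measurable_funM; last first.
      exact: measurableT_comp measurable_invsq_weight measurable_snd.
    apply: measurable_funB; last exact: measurableT_comp measurable_sin ms.
    apply: measurable_funM => //.
    by apply: measurableT_comp measurable_snd; exact: measurable_indic.
  + by move=> A; exact: symmetric_measure_preimage.
  + move=> theta; rewrite -RintegralN; apply: eq_Rintegral => r _.
    by rewrite /h sN sinN; ring.
- by rewrite fineK.
- rewrite fineK// integral_levy//.
  + apply: measurable_funB => //.
    exact: (measurableT_comp measurable_cos (measurable_dotp xi)).
  + by rewrite /dotp big1 ?cos0 ?subrr// => i _; rewrite mxE mul0r.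
Qed.
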